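(* There is an absolute constant $c>0$ such that for every positive integer $k$, every $\delta\in(0,1)$ and all sufficiently large $n$, there exist an instance of online weighted bipartite matching with $n$ online and $n$ offline vertices and a probability distribution over arrival orders of the online vertices satisfying the $(k,\delta)$-uniform-induced-ordering property such that the competitive ratio of the Korula–Pál algorithm on this instance (ratio of the optimal matching weight to the expected weight of the algorithm's matching) is at least $c\,\frac{\delta^2}{(k+1)!}\cdot\frac{n}{\ln n}$.
   Context: Online weighted bipartite matching: offline vertices are known in advance; online vertices arrive one at a time in an order $\pi$ drawn from a distribution; upon arrival of an online vertex its incident weighted edges are revealed and the algorithm irrevocably decides which (if any) incident edge to add, maintaining a matching; the objective is total weight. Korula–Pál algorithm: draw $\tau\sim\mathrm{Binom}(n,\frac12)$; the first $\tau$ online vertices are only observed. For each later online vertex $v$, compute a maximum-weight matching in the graph consisting of the offline vertices, the online vertices arrived in rounds $1,\dots,\tau$, and $v$ (ignoring other vertices arrived after round $\tau$); if $v$ is matched in it to an offline vertex $u$ (tentative edge) and $u$ is not yet matched by the algorithm, add the edge $(v,u)$. $(k,\delta)$-uniform-induced-ordering property: for every $k$ distinct online vertices $y_1,\dots,y_k$, $\Pr[\pi(y_1)<\dots<\pi(y_k)]\ge(1-\delta)/k!$, where $\pi(y)$ is the arrival time of $y$. *)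

(* Defs.v *)
From HB Require Import structures.
From mathcomp Require Import all_boot all_order all_algebra all_fingroup.
From mathcomp Require Import reals exp.

Set Implicit Arguments.
Unset Strict Implicit.
Unset Printing Implicit Defensive.

Import Order.TTheory GRing.Theory Num.Theory.
Local Open Scope ring_scope.

(* Online and offline vertices are both indexed by 'I_n; an edge is a pair
   (online vertex, offline vertex). *)
Record instance (R : realType) (n : nat) := Instance {
  edges : {set 'I_n * 'I_n};
  weight : 'I_n * 'I_n -> R;
  weight_ge0 : forall e, e \in edges -> 0 <= weight e
}.

Section Matching.
Variables (R : realType) (n : nat) (I : instance R n).
Implicit Types (S : {set 'I_n}) (M : {set 'I_n * 'I_n}).

(* M is a matching of the subgraph induced by all the offline vertices and the
   online vertices in S. *)
Definition matching S M : bool :=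
  [&& M \subset edges I,
      [forall e in M, e.1 \in S] &
      [forall e in M, forall f in M,
         ((e.1 == f.1) || (e.2 == f.2)) ==> (e == f)]].

Definition mweight M : R := \sum_(e in M) weight I e.

Definition max_weight_matching S M : Prop :=
  matching S M /\ forall M', matching S M' -> mweight M' <= mweight M.

(* The default 0 of the big max is the weight of the empty matching. *)
Definition opt : R := \big[Num.max/0]_(M | matching [set: 'I_n] M) mweight M.

End Matching.

(* In an arrival order pi : 'S_n, the number pi y is the arrival time of the
   online vertex y, counted from 0. *)
Definition is_distribution (R : realType) (n : nat) (P : 'S_n -> R) : Prop :=
  (forall pi, 0 <= P pi) /\ \sum_pi P pi = 1.

Definition uniform_induced_ordering (R : realType) (n : nat)
    (k : nat) (delta : R) (P : 'S_n -> R) : Prop :=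
  forall y : k.-tuple 'I_n, uniq y ->
    (1 - delta) / k`!%:R
      <= \sum_(pi : 'S_n | sorted ltn [seq val (pi v) | v <- y]) P pi.

Section KorulaPal.
Variables (R : realType) (n : nat) (I : instance R n).

Definition observed (pi : 'S_n) (tau : nat) : {set 'I_n} :=
  [set y | (pi y < tau)%N].

(* rule pi tau v is the maximum-weight matching computed when v arrives.
   The algorithm does not say which one is taken when there are several, so
   the choice is a parameter, and may depend on the whole run. *)
Definition matching_rule := 'S_n -> nat -> 'I_n -> {set 'I_n * 'I_n}.

Definition valid_rule (rule : matching_rule) : Prop :=
  forall (pi : 'S_n) (tau : nat) (v : 'I_n), (tau <= pi v)%N ->
    max_weight_matching I (v |: observed pi tau) (rule pi tau v).

Variable rule : matching_rule.

Definition kp_step (pi : 'S_n) (tau : nat) (M : {set 'I_n * 'I_n}) (v : 'I_n) :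
    {set 'I_n * 'I_n} :=
  if [pick u | (v, u) \in rule pi tau v] is Some u then
    if [exists e in M, e.2 == u] then M else (v, u) |: M
  else M.

Definition korula_pal (pi : 'S_n) (tau : nat) : {set 'I_n * 'I_n} :=
  foldl (kp_step pi tau) set0
    [seq (pi^-1)%g t | t <- enum 'I_n & (tau <= val t)%N].

(* The order pi is drawn from P and, independently, tau from Binom(n, 1/2). *)
Definition kp_expected_weight (P : 'S_n -> R) : R :=
  \sum_(pi : 'S_n) P pi *
    \sum_(tau < n.+1) 'C(n, tau)%:R / 2 ^+ n * mweight I (korula_pal pi tau).

(* For nonnegative P of total mass 1 and a valid rule the denominator vanishes
   only when opt I = 0 (consider tau = 0). *)
Definition kp_competitive_ratio (P : 'S_n -> R) : R :=
  opt I / kp_expected_weight P.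

End KorulaPal.

(* Main.v *)
Require Import Defs.
From HB Require Import structures.
From mathcomp Require Import all_boot all_order all_algebra all_fingroup.
From mathcomp Require Import reals exp sequences ring lra.

Set Implicit Arguments.
Unset Strict Implicit.
Unset Printing Implicit Defensive.

Import Order.TTheory GRing.Theory Num.Theory.
Local Open Scope ring_scope.

(* The order is drawn uniformly from m = O((k+1)! ln n / delta^2) fixed orders
   pi_0, ..., pi_(m-1): by a Chernoff bound and a union bound over the k-tuples,
   made effective by choosing the orders greedily, such a list with the
   uniform-induced-ordering property exists.
   The instance gives n - m online vertices a private neighbour of weight 1, and
   joins all of them to m shared offline vertices; the edge from v to the shared
   vertex u has weight between 1 and 2, increasing in the arrival time of v
   under pi_u. If the order is pi_u, an arriving v is later than every observed
   vertex, so a maximum-weight matching must use v at a shared vertex: otherwise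
   move v to u and send the former mate of u to its private neighbour. Hence all
   tentative edges go to the m shared vertices, and the algorithm earns at most
   2m for every tau, while the optimum is at least n - m. *)

(** * Orders induced on a tuple by uniform permutations *)

Lemma perm_eq_map_perm (T : finType) (y z : seq T) :
  uniq y -> perm_eq y z -> exists rho : {perm T}, map rho z = y.
Proof.
move=> uy yz; have uz : uniq z by rewrite -(perm_uniq yz).
have szyz := perm_size yz.
(* [f] matches the entries of [z] and [y] position by position and fixes all else; as [y] and [z]
   have the same elements, it is a bijection. *)
pose f v := if v \in z then nth v y (index v z) else v.
have fin v : (f v \in z) = (v \in z).
  rewrite /f; case: ifP => [vz|->//].
  by rewrite -(perm_mem yz) mem_nth // szyz index_mem.
have f_inj : injective f.
  move=> v w efvw; have := fin v; rewrite efvw fin => wv.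
  move: efvw; rewrite /f wv; case: ifP => // vz.
  rewrite (set_nth_default w) ?szyz ?index_mem // => /eqP.
  rewrite nth_uniq ?szyz ?index_mem ?wv // => /eqP e.
  by rewrite -(nth_index w vz) e nth_index // wv.
exists (perm f_inj).
have -> : [seq perm f_inj v | v <- z] = [seq f v | v <- z].
  by apply: eq_map => v; rewrite permE.
case: (posnP (size z)) => [z0|].
  by move: szyz; rewrite (size0nil z0) => /size0nil ->.
rewrite lt0n => /eqP z0; have [a _] : {a | a \in z}.
  by case: (z) z0 => // a ? _; exists a; rewrite mem_head.
apply: (@eq_from_nth _ a); rewrite size_map ?szyz // => i iz.
rewrite (nth_map a) // /f mem_nth // index_uniq //.
by apply: set_nth_default; rewrite szyz.
Qed.

Section InducedOrder.
Variable n : nat.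
Implicit Types (y z : seq 'I_n) (pi : 'S_n).

Definition induces y pi := sorted ltn [seq val (pi v) | v <- y].

(** Left multiplication by the [rho] carrying [z] to [y] is injective and turns orders increasing
    along [y] into orders increasing along [z]. *)
Lemma leq_card_induces y z : uniq y -> perm_eq y z ->
  (#|[set pi | induces y pi]| <= #|[set pi | induces z pi]|)%N.
Proof.
move=> uy yz; have [rho rhoz] := perm_eq_map_perm uy yz.
rewrite -(card_imset _ (mulgI rho)); apply/subset_leq_card/subsetP.
move=> _ /imsetP[pi /[!inE] ipi ->].
rewrite /induces; rewrite (_ : map _ _ = [seq val (pi v) | v <- y]) //.
by rewrite -rhoz -map_comp; apply: eq_map => v /=; rewrite permM.
Qed.

Lemma exists_induces y pi : uniq y -> exists2 z, perm_eq z y & induces z pi.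
Proof.
move=> uy; pose r := relpre (fun v => val (pi v)) leq.
exists (sort r y); first exact/permPl/perm_sort.
rewrite /induces ltn_sorted_uniq_leq map_inj_uniq ?sort_uniq ?uy /=.
  by rewrite sorted_map sort_sorted // => a b; apply: leq_total.
by move=> a b /val_inj/perm_inj.
Qed.

(** Every order sorts some rearrangement of [y], and by symmetry none of the rearrangements is
    induced more often than [y] itself. *)
Lemma leq_fact_card_induces y : uniq y ->
  (#|{: 'S_n}| <= (size y)`! * #|[set pi | induces y pi]|)%N.
Proof.
move=> uy; rewrite -(size_permutations uy).
apply: (@leq_trans (\sum_(z <- permutations y) #|[set pi | induces z pi]|)%N).
  under eq_bigr do rewrite -sum1dep_card big_mkcond.
  rewrite exchange_big /= -sum1_card leq_sum // => pi _.
  have [z zy iz] := exists_induces pi uy.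
  rewrite -mem_permutations in zy.
  by rewrite (big_rem z) //= iz.
rewrite -sum1_size big_distrl /= big_seq [leqRHS]big_seq leq_sum // => z.
rewrite mem_permutations mul1n => zy.
by rewrite leq_card_induces // (perm_uniq zy).
Qed.

End InducedOrder.

(** * Chernoff bound with greedily chosen samples *)

Section Sampling.
Variables (R : realType) (Omega Y : finType) (good : Y -> pred Omega).
Variables (p : R) (w0 : Omega).
Hypothesis good_ge : forall y, p * #|Omega|%:R <= #|good y|%:R.

Lemma prob_le1 (y : Y) : p <= 1.
Proof.
have O0 : 0 < #|Omega|%:R :> R by rewrite ltr0n; apply/card_gt0P; exists w0.
rewrite -(ler_pM2r O0) mul1r; apply: le_trans (good_ge y) _.
by rewrite ler_nat max_card.
Qed.

Lemma exists_le_average (f : Omega -> R) (a : R) :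
  \sum_w f w <= #|Omega|%:R * a -> exists w, f w <= a.
Proof.
move=> fa; apply/existsP; apply: contraLR fa; rewrite negb_exists => /forallP fa.
rewrite -ltNge mulr_natl -sumr_const ltr_sum // => [|w _]; last by rewrite ltNge.
by apply/hasP; exists w0; rewrite ?mem_index_enum.
Qed.

(* The conditional-expectation form of the exponential moment bound: each new
   sample can be chosen to shrink the total by the average factor. *)
Lemma exists_sample_exp_moment (b : R) (m : nat) : 0 <= b <= 1 ->
  exists2 s : seq Omega, size s = m &
    \sum_y b ^+ count (good y) s <= #|Y|%:R * (1 - p * (1 - b)) ^+ m.
Proof.
move=> /andP[b0 b1]; elim: m => [|m [s ss IH]].
  exists [::] => //=; under eq_bigr do rewrite expr0.
  by rewrite sumr_const expr0 mulr1.
have [|w Hw] := @exists_le_average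
    (fun w => \sum_y b ^+ count (good y) (w :: s))
    ((1 - p * (1 - b)) * \sum_y b ^+ count (good y) s).
  rewrite exchange_big /= mulrA mulr_sumr ler_sum // => y _.
  under eq_bigr do rewrite exprD.
  rewrite -mulr_suml ler_wpM2r ?exprn_ge0 //.
  have -> : \sum_w b ^+ good y w = #|Omega|%:R - (1 - b) * #|good y|%:R.
    transitivity (\sum_w (1 - (1 - b) * (good y w)%:R)).
      by apply: eq_bigr => w _; case: (good y w) => /=; ring.
    rewrite sumrB sumr_const -mulr_sumr -natr_sum; congr (_ - _ * _%:R).
    rewrite -sum1_card [RHS]big_mkcond /=; apply: eq_bigr => w _.
    by rewrite unfold_in; case: (good y w).
  have := good_ge y; have : 0 <= 1 - b by lra.
  by nra.
exists (w :: s); first by rewrite /= ss.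
apply: le_trans Hw _; rewrite exprS mulrCA.
(* The bound [p <= 1] comes from some [y]; for empty [Y] both sides are zero. *)
case: (pickP (mem Y)) => [y _|Y0]; last first.
  by rewrite big_pred0 // mulr0 (eq_card0 Y0) mul0r mulr0.
have p1 := prob_le1 y.
by apply: ler_wpM2l => //; nra.
Qed.

(** Each moment [b ^+ count] is at most the sum over [Y], so bounding that sum already contains the
    union bound; taking logarithms yields the lower tail. *)
Lemma exists_sample (delta : R) (m : nat) : 0 < delta -> 0 <= p ->
  #|Y|%:R <= expR (p * m%:R * delta ^+ 2 / 4) ->
  exists2 s : seq Omega, size s = m &
    forall y, (1 - delta) * p * m%:R <= (count (good y) s)%:R.
Proof.
(* With [l = delta / 2], the hypothesis on [#|Y|] and the quadratic error in [b] each cost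
   [p * m * l ^+ 2]; together this is [delta * l * p * m]. *)
move=> d0 p0 Ym; pose l := delta / 2; pose b := expR (- l).
have l0 : 0 < l by rewrite /l; lra.
have b0 : 0 <= b by apply: expR_ge0.
(* This follows from [1 + l <= expR l], since (1 + l)(1 - l + l^2) = 1 + l^3. *)
have bl : b <= 1 - l + l ^+ 2.
  have e1 := expR_ge1Dx l.
  rewrite /b expRN -[leLHS]mulr1 ler_pdivrMl ?expR_gt0 //.
  have : 0 <= 1 - l + l ^+ 2 by nra.
  by nra.
have b1 : b <= 1 by rewrite /b -expR0 ler_expR; lra.
have [|s ss Hs] := @exists_sample_exp_moment b m; first by rewrite b0.
exists s => // y; have p1 := prob_le1 y.
have : b ^+ count (good y) s <=
    expR (p * m%:R * delta ^+ 2 / 4 - m%:R * (p * (1 - b))).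
  apply: le_trans (_ : \sum_y b ^+ count (good y) s <= _).
    by rewrite (bigD1 y) //= lerDl sumr_ge0 // => z _; rewrite exprn_ge0.
  apply: le_trans Hs _; rewrite expRD ler_pM //.
  - have : p * (1 - b) <= 1 by nra.
    by move=> ?; rewrite exprn_ge0 //; lra.
  - rewrite -(mulrN m%:R) expRM_natl lerXn2r ?nnegrE ?expR_ge0 //.
      by have : p * (1 - b) <= 1; [nra|lra].
    by have := expR_ge1Dx (- (p * (1 - b))).
rewrite {1}/b -expRM_natl ler_expR.
have pm0 : 0 <= p * m%:R by rewrite mulr_ge0.
rewrite -[(1 - _) * _ * _ <= _](ler_pM2l l0) /l.
by have := ler_wpM2l pm0 bl; rewrite /l; move: {+}b => c; lra.
Qed.
End Sampling.

(** * Matchings and their weights *)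

Section MatchingTheory.
Variables (R : realType) (n : nat) (I : instance R n).
Implicit Types (S : {set 'I_n}) (M : {set 'I_n * 'I_n}).

Lemma matchingP S M : reflect
  [/\ {subset M <= edges I}, (forall e, e \in M -> e.1 \in S) &
      forall e f, e \in M -> f \in M -> e.1 = f.1 \/ e.2 = f.2 -> e = f]
  (matching I S M).
Proof.
apply: (iffP and3P) => [[/subsetP sM /forall_inP SM uM]|[sM SM uM]].
  split=> // e f eM fM ef; apply/eqP.
  have /forall_inP/(_ f fM)/implyP := forall_inP uM e eM; apply.
  by case: ef => ->; rewrite eqxx ?orbT.
split; [exact/subsetP | exact/forall_inP |].
apply/forall_inP => e eM; apply/forall_inP => f fM; apply/implyP => /orP ef.
by apply/eqP/uM => //; case: ef => /eqP; [left | right].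
Qed.

Lemma matching_subset S M M' : M' \subset M -> matching I S M -> matching I S M'.
Proof.
move=> /subsetP M'M /matchingP[sM SM uM]; apply/matchingP.
by split=> [e /M'M/sM|e /M'M/SM|e f /M'M eM /M'M fM] //; apply: uM.
Qed.

Lemma matching_add S M v u : matching I S M -> (v, u) \in edges I -> v \in S ->
  (forall e, e \in M -> e.1 != v /\ e.2 != u) -> matching I S ((v, u) |: M).
Proof.
move=> /matchingP[sM SM uM] vuI vS free; apply/matchingP; split.
- by move=> e /setU1P[->|/sM].
- by move=> e /setU1P[->|/SM].
move=> e f /setU1P[->|eM] /setU1P[->|fM] //= ef; last exact: uM.
  by have [] := free f fM; case: ef => ->; rewrite eqxx.
by have [] := free e eM; case: ef => ->; rewrite eqxx.
Qed.

Lemma mweightU1 M e : e \notin M -> mweight I (e |: M) = weight I e + mweight I M.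
Proof. by move=> eM; rewrite /mweight big_setU1. Qed.

Lemma mweightD1 M e : e \in M -> mweight I M = weight I e + mweight I (M :\ e).
Proof. by move=> eM; rewrite /mweight (big_setD1 e). Qed.

(** Spares the exchange argument a case split on whether the private edge of [v] is in the
    matching. *)
Lemma mweightD1_ge M e : 0 <= weight I e ->
  mweight I M - weight I e <= mweight I (M :\ e).
Proof.
move=> we; have [/mweightD1 ->|eM] := boolP (e \in M); first by rewrite addrC addKr.
have /setDidPl -> : [disjoint M & [set e]] by rewrite disjoint_sym disjoints1.
by rewrite gerBl.
Qed.

End MatchingTheory.

(** * The hard instance *)

Section HardInstance.
Variables (R : realType) (n : nat) (s : seq 'S_n).
Let m := size s.

(* Offline vertices below m are shared, one per order in s, and online vertices
   below m are isolated, so that the remaining private edges (v, v) fit. *)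
Definition hard_edges : {set 'I_n * 'I_n} :=
  [set e : 'I_n * 'I_n | (m <= e.1)%N && ((e.2 < m)%N || (e.1 == e.2))].

(** The successor makes even the earliest vertex prefer a shared edge to its private one; dividing
    by [n] caps weights at 2. *)
Definition hard_weight (e : 'I_n * 'I_n) : R :=
  if (e.2 < m)%N then 1 + (nth 1%g s e.2 e.1).+1%:R / n%:R else 1.

Lemma hard_weight_gt0 e : 0 < hard_weight e.
Proof.
by rewrite /hard_weight; case: ifP => // _; rewrite ltr_pwDl // divr_ge0.
Qed.

Lemma hard_weight_le2 e : hard_weight e <= 2.
Proof.
rewrite /hard_weight; case: ifP => _; last by rewrite ler1n.
have n0 : 0 < n%:R :> R by rewrite ltr0n (leq_trans _ (ltn_ord e.1)).
have : (nth 1%g s e.2 e.1).+1%:R / n%:R <= 1 :> R.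
  by rewrite ler_pdivrMr // mul1r ler_nat.
lra.
Qed.

Definition hard_instance : instance R n :=
  Instance (fun e (_ : e \in hard_edges) => ltW (hard_weight_gt0 e)).
Local Notation I := hard_instance.

Lemma edge_online e : e \in edges I -> (m <= e.1)%N.
Proof. by rewrite inE => /andP[]. Qed.

Lemma private_edge (v : 'I_n) : (m <= v)%N -> (v, v) \in edges I.
Proof. by move=> mv; rewrite inE /= mv eqxx orbT. Qed.

Lemma shared_edge (v u : 'I_n) : (m <= v)%N -> (u < m)%N -> (v, u) \in edges I.
Proof. by move=> mv um; rewrite inE /= mv um. Qed.

Lemma private_weight (v : 'I_n) : (m <= v)%N -> weight I (v, v) = 1.
Proof. by move=> mv; rewrite /= /hard_weight ltnNge mv. Qed.

Lemma shared_weight_gt1 (v u : 'I_n) : (u < m)%N -> 1 < weight I (v, u).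
Proof.
move=> um; rewrite /= /hard_weight um ltrDl divr_gt0 // ltr0n.
by rewrite (leq_trans _ (ltn_ord v)).
Qed.

Lemma shared_weight_lt (v v' u : 'I_n) : (u < m)%N ->
  (nth 1%g s u v' < nth 1%g s u v)%N -> weight I (v', u) < weight I (v, u).
Proof.
move=> um vv'; rewrite /= /hard_weight um ltrD2l ltr_pM2r ?ltr_nat //.
by rewrite invr_gt0 ltr0n (leq_trans _ (ltn_ord v)).
Qed.

Lemma hard_opt_ge : (n - m)%:R <= opt I.
Proof.
pose D := [set (v, v) | v in [set v : 'I_n | (m <= v)%N]].
have -> : (n - m)%:R = mweight I D.
  rewrite /mweight big_imset; last by move=> v w _ _ [].
  rewrite (eq_bigr (fun=> 1%:R)) => [|v /[!inE] mv]; last exact: private_weight.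
  rewrite -natr_sum; congr _%:R.
  transitivity (\sum_(m <= i < n) 1)%N; first by rewrite sum_nat_const_nat muln1.
  by rewrite big_geq_mkord; apply: eq_bigl => v; rewrite inE.
apply: le_bigmax_cond; apply/matchingP; split=> //.
  by move=> _ /imsetP[v /[!inE] mv ->]; rewrite /= mv eqxx orbT.
by move=> _ _ /imsetP[v _ ->] /imsetP[w _ ->] /= [] ->.
Qed.

(* Exchange argument: v is the last vertex of v |: observed pi tau in the order
   pi, so it is the heaviest one at the shared vertex of pi; the vertex it
   evicts falls back to its private edge. *)
Lemma hard_tentative_shared pi tau v M : pi \in s -> (m <= n)%N ->
  (tau <= pi v)%N -> (m <= v)%N ->
  max_weight_matching I (v |: observed pi tau) M ->
  exists2 u : 'I_n, (u < m)%N & (v, u) \in M.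
Proof.
move=> pis mn tauv mv [mM maxM].
have /matchingP[sM SM uM] := mM.
have jm : (index pi s < m)%N by rewrite index_mem.
(* [u] is the shared vertex whose weights increase along the actual order [pi]. *)
pose u := Ordinal (leq_trans jm mn).
have um : (u < m)%N by [].
have piu : nth 1%g s u = pi by rewrite nth_index.
have vS : v \in v |: observed pi tau by rewrite !inE eqxx.
apply/exists_inP; apply: contraT => /exists_inPn noshared.
have v_private e : e \in M -> e.1 = v -> e = (v, v).
  case: e => a b eM /= ea; rewrite {a}ea in eM *.
  have := sM _ eM; rewrite inE /= mv /=.
  case/orP=> [bm|/eqP <- //]; by have := noshared b bm; rewrite eM.
have vv_ge0 : 0 <= weight I (v, v) by rewrite ltW // hard_weight_gt0.
have [/exists_inP[e eM /eqP eu]|/exists_inPn nou] :=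
  boolP [exists e in M, e.2 == u]; last first.
  have free e : e \in M :\ (v, v) -> e.1 != v /\ e.2 != u.
    case/setD1P=> evv eM; split; last exact: nou.
    by apply: contraNneq evv => /(v_private e eM) ->.
  have := maxM _ (matching_add (matching_subset (subD1set _ _) mM)
                    (shared_edge mv um) vS free).
  rewrite mweightU1; last by apply/negP => /free[]; rewrite eqxx.
  have := mweightD1_ge M vv_ge0; rewrite private_weight //.
  have := shared_weight_gt1 v um; lra.
case: e eM eu => v' u' eM /= eu; rewrite {u'}eu in eM.
have v'v : v' != v.
  by apply: contraTneq eM => ->; apply: noshared.
have mv' : (m <= v')%N := edge_online (sM _ eM).
have v'S := SM _ eM; rewrite /= in v'S.
have v'lt : (pi v' < pi v)%N.
  by move: v'S; rewrite !inE (negPf v'v) /= => /leq_trans; apply.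
have M1 := matching_subset (subD1set M (v', u)) mM.
(* The offline vertex [v'] is not shared, so its only edge is the private one and it is free once
   [v'] leaves [u]. *)
have free1 e : e \in M :\ (v', u) -> e.1 != v' /\ e.2 != v'.
  case/setD1P=> ne eM'; split.
    by apply: contraNneq ne => e1; apply/eqP/uM => //=; left.
  apply: contraNneq ne => e2; apply/eqP/uM => //=; left.
  have := sM _ eM'; rewrite inE => /andP[_ /orP[|/eqP]]; rewrite e2 //.
  by rewrite ltnNge mv'.
have M2 := matching_add M1 (private_edge mv') v'S free1.
have free2 e : e \in ((v', v') |: (M :\ (v', u))) :\ (v, v) ->
    e.1 != v /\ e.2 != u.
  case/setD1P=> evv /setU1P[->|/setD1P[ne eM']] /=.
    by split=> //; apply: contraTneq mv' => ->; rewrite -ltnNge.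
  split; first by apply: contraNneq evv => /(v_private e eM') ->.
  by apply: contraNneq ne => e2; apply/eqP/uM => //=; right.
(* The private edges of [v'] and [v] at worst cancel, so the gain is at least the weight of [(v, u)]
   minus that of [(v', u)], which is positive. *)
have := maxM _ (matching_add (matching_subset (subD1set _ _) M2)
                  (shared_edge mv um) vS free2).
rewrite mweightU1; last by apply/negP => /free2[]; rewrite eqxx.
have := mweightD1_ge ((v', v') |: (M :\ (v', u))) vv_ge0.
rewrite mweightU1; last by apply/negP => /free1[]; rewrite eqxx.
rewrite (mweightD1 _ eM) !private_weight //.
have := @shared_weight_lt v v' u um; rewrite piu => /(_ v'lt); lra.
Qed.

(** * Bounds on a run of the algorithm *)

Section Run.
Variables (rule : matching_rule n) (pi : 'S_n) (tau : nat).
Hypotheses (mn : (m < n)%N) (pis : pi \in s) (valid : valid_rule I rule).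

Let shared_inj (M : {set 'I_n * 'I_n}) :=
  (forall e, e \in M -> (e.2 < m)%N) /\ {in M &, injective snd}.

(** The rule's matching has a single edge at [v], which is therefore the shared one. The invariant
    bounds the number of edges by [m]. *)
Lemma kp_step_shared_inj M v : (tau <= pi v)%N ->
  shared_inj M -> shared_inj (kp_step rule pi tau M v).
Proof.
move=> tauv [sM iM]; rewrite /kp_step.
case: pickP => [u vu|_]; last by split.
case: ifPn => [_|/exists_inPn Mu]; first by split.
have maxr := valid tauv; have [/matchingP[sr _ ur] _] := maxr.
have mv := edge_online (sr _ vu).
have [u' u'm vu'] := hard_tentative_shared pis (ltnW mn) tauv mv maxr.
have [uu'] : (v, u) = (v, u') by apply: ur => //; left.
split=> [e /setU1P[->|/sM] //|]; first by rewrite /= uu'.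
move=> e f /setU1P[->|eM] /setU1P[->|fM] //= ef; last exact: iM.
  by have := Mu f fM; rewrite ef eqxx.
by have := Mu e eM; rewrite ef eqxx.
Qed.

Lemma kp_late v : v \in [seq (pi^-1)%g t | t <- enum 'I_n & (tau <= val t)%N] ->
  (tau <= pi v)%N.
Proof. by move=> /mapP[t /[!mem_filter] /andP[taut _] ->]; rewrite permKV. Qed.

Lemma korula_pal_weight_le : mweight I (korula_pal rule pi tau) <= 2 * m%:R.
Proof.
have [sK iK] : shared_inj (korula_pal rule pi tau).
  rewrite /korula_pal; have := kp_late; set l := [seq _ | _ <- _].
  have : shared_inj set0 by split=> [e|e f]; rewrite inE.
  elim: l (set0 : {set _}) => //= v l IH M iM late; apply: IH => [|w wl].
    by apply: kp_step_shared_inj => //; apply: late; rewrite mem_head.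
  by apply: late; rewrite inE wl orbT.
apply: (@le_trans _ _ (\sum_(e in korula_pal rule pi tau) 2)).
  by apply: ler_sum => e _; apply: hard_weight_le2.
rewrite sumr_const -[leLHS]mulr_natr ler_pM2l // ler_nat -(card_in_imset iK).
apply: leq_trans (subset_leq_card (_ : _ \subset [set u : 'I_n | (u < m)%N])) _.
  by apply/subsetP => _ /imsetP[e eK ->]; rewrite inE sK.
rewrite -sum1dep_card -(big_ord_widen n (fun=> 1%N) (ltnW mn)).
by rewrite sum1_card card_ord.
Qed.

Lemma kp_step_mono (M : {set _}) v : M \subset kp_step rule pi tau M v.
Proof.
rewrite /kp_step; case: pickP => // u _; case: ifP => // _; exact: subsetUr.
Qed.

Lemma korula_pal_weight_ge0 : 0 <= mweight I (korula_pal rule pi tau).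
Proof. by apply: sumr_ge0 => e _; apply/ltW/hard_weight_gt0. Qed.

(** When the non-isolated vertex [m] arrives, either its tentative edge is added or the offline end
    is already matched; edges are never removed. *)
Lemma korula_pal0_weight_gt0 : tau = 0%N -> 0 < mweight I (korula_pal rule pi tau).
Proof.
move=> tau0; suff /set0Pn[e eK] : korula_pal rule pi tau != set0.
  rewrite /mweight (bigD1 e) //= ltr_pwDl ?hard_weight_gt0 //.
  by apply: sumr_ge0 => f _; apply/ltW/hard_weight_gt0.
pose v := Ordinal mn.
have tauv : (tau <= pi v)%N by rewrite tau0.
have [u _ vu] := hard_tentative_shared pis (ltnW mn) tauv (leqnn m) (valid tauv).
have : v \in [seq (pi^-1)%g t | t <- enum 'I_n & (tau <= val t)%N].
  by apply/mapP; exists (pi v); rewrite ?permK // mem_filter tauv mem_enum.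
rewrite /korula_pal; move: {1}set0 => M; elim: [seq _ | _ <- _] M => //= w l IH M.
rewrite inE => /predU1P[<-|/IH //].
have : kp_step rule pi tau M v != set0.
  rewrite /kp_step; case: pickP => [u' _|/(_ u)]; last by rewrite vu.
  case: ifP => [/exists_inP[e eM _]|_]; apply/set0Pn; first by exists e.
  by exists (v, u'); rewrite setU11.
elim: l (kp_step _ _ _ _ _) {IH} => //= x l IH M' /set0Pn[e eM']; apply: IH.
by apply/set0Pn; exists e; apply: (subsetP (kp_step_mono _ _)).
Qed.

End Run.

Lemma binomial_law_sum1 : \sum_(tau < n.+1) 'C(n, tau)%:R / 2 ^+ n = 1 :> R.
Proof.
rewrite -mulr_suml -natr_sum (_ : (\sum_(_ < _) _ = 2 ^ n)%N).
  by rewrite natrX divff // expf_neq0 // pnatr_eq0.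
rewrite -[in RHS]addn1 expnDn; apply: eq_bigr => i _.
by rewrite !exp1n !muln1.
Qed.

(** Positivity, from the [tau = 0] term at an order of positive mass, keeps the competitive ratio
    from being a division by zero. *)
Lemma kp_expected_weight_bounds (rule : matching_rule n) (P : 'S_n -> R) :
    (m < n)%N -> valid_rule I rule -> is_distribution P ->
    (forall pi, pi \notin s -> P pi = 0) ->
  0 < kp_expected_weight I rule P <= 2 * m%:R.
Proof.
move=> mn valid [P0 P1] Ps; pose c tau : R := 'C(n, tau)%:R / 2 ^+ n.
have c0 tau : 0 <= c tau by rewrite divr_ge0 // exprn_ge0.
have inner_ge0 pi :
    0 <= \sum_(tau < n.+1) c tau * mweight I (korula_pal rule pi tau).
  by apply: sumr_ge0 => tau _; rewrite mulr_ge0 // korula_pal_weight_ge0.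
apply/andP; split.
  have [pi Ppi] : exists pi, 0 < P pi.
    apply/existsP; apply: contraTT isT; rewrite negb_exists => /forallP nP.
    have : \sum_pi P pi <= 0 by apply: sumr_le0 => pi _; rewrite leNgt.
    by rewrite P1 ler10.
  have pis : pi \in s by apply: contraTT Ppi => /Ps ->; rewrite ltxx.
  rewrite /kp_expected_weight (bigD1 pi) //= ltr_pwDl //; last first.
    by apply: sumr_ge0 => pi' _; rewrite mulr_ge0.
  rewrite mulr_gt0 // big_ord_recl /= ltr_pwDl //; last first.
    by apply: sumr_ge0 => tau _; rewrite mulr_ge0 ?korula_pal_weight_ge0 //; apply: c0.
  rewrite mulr_gt0 // ?korula_pal0_weight_gt0 //.
  by rewrite bin0 divr_gt0 // exprn_gt0.
rewrite -[leRHS]mul1r -[X in _ <= X * _]P1 mulr_suml; apply: ler_sum => pi _.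
have [pis|/Ps ->] := boolP (pi \in s); last by rewrite !mul0r.
rewrite ler_wpM2l // -[leRHS]mul1r -[X in _ <= X * _]binomial_law_sum1 mulr_suml.
apply: ler_sum => tau _; apply: (ler_wpM2l (c0 tau)); exact: korula_pal_weight_le.
Qed.

End HardInstance.

(** * The empirical distribution of a list of orders *)

Section Empirical.
Variables (R : realType) (n : nat) (s : seq 'S_n).

Definition empirical (pi : 'S_n) : R := (count_mem pi s)%:R / (size s)%:R.

Lemma sum_empirical (a : pred 'S_n) :
  \sum_(pi | a pi) empirical pi = (count a s)%:R / (size s)%:R.
Proof.
rewrite -mulr_suml -natr_sum; congr (_%:R / _).
elim: s => [|x l IH] /=; first by rewrite big1.
rewrite big_split /= IH; congr addn.
rewrite big_mkcond (bigD1 x) //= eqxx big1 ?addn0; first by case: (a x).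
by move=> pi /negPf; rewrite eq_sym => ->; case: (a pi).
Qed.

Lemma empirical_distribution : s != [::] -> is_distribution empirical.
Proof.
rewrite -size_eq0 => s0; split=> [pi|]; first by rewrite divr_ge0.
by rewrite sum_empirical count_predT divff // pnatr_eq0.
Qed.

End Empirical.

(** Sampling with success probability [1 / k!], over the at most [n ^ k] duplicate-free tuples. *)
Lemma exists_empirical_uniform (R : realType) (n k m : nat) (delta : R) :
    (0 < m)%N -> 0 < delta ->
    (n ^ k)%:R <= expR (m%:R * delta ^+ 2 / (4 * k`!%:R)) ->
  exists2 s : seq 'S_n, size s = m &
    uniform_induced_ordering k delta (empirical R s).
Proof.
move=> m0 d0 nk; pose Y : finType := {y : k.-tuple 'I_n | uniq y}.
have k0 : 0 < k`!%:R :> R by rewrite ltr0n fact_gt0.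
have [||||s ss Hs] := @exists_sample R _ Y (fun y => @induces n (val y))
  k`!%:R^-1 1%g _ delta m.
- move=> y; rewrite ler_pdivrMl // -natrM ler_nat.
  have := leq_fact_card_induces (valP y); rewrite size_tuple cardsE.
  exact: leq_trans.
- by [].
- by rewrite invr_ge0 ltW.
- apply: le_trans (_ : (n ^ k)%:R <= _).
    by rewrite ler_nat card_sig (leq_trans (max_card _)) // card_tuple card_ord.
  apply: le_trans nk _; rewrite ler_expR le_eqVlt; apply/orP; left; apply/eqP.
  by field; rewrite gt_eqF.
exists s => // y uy; rewrite sum_empirical ss ler_pdivlMr ?ltr0n //.
exact: (Hs (Sub y uy)).
Qed.

(** * Choice of the constants *)

Lemma ln_le_sqrt (R : realType) (x : R) : 0 < x -> ln x <= 2 * Num.sqrt x.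
Proof.
move=> x0; have sx : 0 < Num.sqrt x by rewrite sqrtr_gt0.
rewrite -{1}(sqr_sqrtr (ltW x0)) lnXn // -[leLHS]mulr_natl ler_pM2l //.
rewrite -{1}[Num.sqrt x](subrK 1) addrC.
by apply: le_trans (le_ln1Dx _) _; lra.
Qed.

Theorem mainTheorem19 (R : realType) :
  exists c : R, 0 < c /\
    forall (k : nat) (delta : R), (0 < k)%N -> 0 < delta -> delta < 1 ->
      exists N : nat, forall n : nat, (N <= n)%N ->
        exists (I : instance R n) (P : 'S_n -> R),
          is_distribution P /\
          uniform_induced_ordering k delta P /\
          forall rule : matching_rule n, valid_rule I rule ->
            c * (delta ^+ 2 / (k.+1)`!%:R) * (n%:R / ln (n%:R))
              <= kp_competitive_ratio I rule P.
Proof.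
(* The optimum is at least [n / 2] and the algorithm earns at most [2 * m <= 4 * A * L]; with
   [A = 4 * F / delta ^+ 2] the quotient is at least [n * delta ^+ 2 / (32 * F * L)]. *)
exists (1 / 32); split; first by lra.
move=> k delta k0 d0 d1.
(* The union bound needs [m] at least [4 * k * k! * ln n / delta ^+ 2], and [k * k! <= (k+1)!]. *)
pose F : R := (k.+1)`!%:R; pose A := 4 * F / delta ^+ 2.
have F1 : 1 <= F by rewrite ler1n fact_gt0.
have dd0 : 0 < delta ^+ 2 by rewrite exprn_gt0.
have A4 : 4 <= A by rewrite ler_pdivlMr //; nra.
(* This threshold gives [8 * A <= sqrt n]; with [ln n <= 2 * sqrt n], then [2 * m <= 4 * A * L <= 8
   * A * sqrt n <= n]. *)
exists (Num.trunc (64 * A ^+ 2)).+1 => n Nn.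
have nA : 64 * A ^+ 2 <= n%:R.
  by apply: le_trans (ltW (truncnS_gt _)) _; rewrite ler_nat.
have n4 : 4 <= n%:R :> R by nra.
have n0 : 0 < n%:R :> R by lra.
set L := ln n%:R.
(* Ensures [1 <= A * L], so that rounding up to [m] at most doubles [A * L]. *)
have L12 : 1 / 2 <= L.
  have n'0 : 0 < n%:R^-1 :> R by rewrite invr_gt0.
  have /le_ln1Dx : -1 < n%:R^-1 - 1 :> R by lra.
  rewrite addrC subrK lnV // -/L.
  have : n%:R^-1 <= 4^-1 :> R by rewrite lef_pV2 ?posrE.
  lra.
pose m := (Num.trunc (A * L)).+1.
have AL1 : 1 <= A * L by nra.
have AL0 : 0 <= A * L by lra.
have mAL : A * L <= m%:R by rewrite ltW // truncnS_gt.
have m2AL : m%:R <= 2 * (A * L).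
  have /andP[tAL _] := truncn_itv AL0; rewrite /m -[leLHS]natr1; lra.
have mn : 2 * m%:R <= n%:R :> R.
  have Ls := ln_le_sqrt n0; rewrite -/L in Ls.
  have s0 : 0 <= Num.sqrt n%:R :> R by rewrite sqrtr_ge0.
  have sn : Num.sqrt n%:R ^+ 2 = n%:R :> R by rewrite sqr_sqrtr // ltW.
  have : 8 * A <= Num.sqrt n%:R.
    rewrite -(@ler_pXn2r _ 2) ?nnegrE //; last by lra.
    by rewrite sn; lra.
  move: (Num.sqrt _) s0 sn Ls => r r0 rn Lr Ar.
  have : A * L <= A * (2 * r) by rewrite ler_pM2l //; lra.
  nra.
have [||s ss Ps] := @exists_empirical_uniform R n k m delta _ d0; first by [].
  rewrite natrX -[n%:R]lnK ?posrE // -expRM_natl ler_expR -/L.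
  have f0 : 0 < k`!%:R :> R by rewrite ltr0n fact_gt0.
  rewrite ler_pdivlMr ?mulr_gt0 //.
  apply: le_trans (_ : A * L * delta ^+ 2 <= _); last by rewrite ler_pM2r.
  rewrite /A /F factS natrM -natr1.
  rewrite [leRHS](_ : _ = 4 * ((k%:R + 1) * k`!%:R) * L); last first.
    by field; rewrite gt_eqF.
  have : 0 <= k`!%:R * L by rewrite mulr_ge0 // ltW //; lra.
  nra.
have mn' : (size s < n)%N.
  by rewrite ss -(ltr_nat R); have : 1 <= m%:R :> R by [rewrite ler1n]; lra.
have dP : is_distribution (empirical R s).
  by apply: empirical_distribution; rewrite -size_eq0 ss.
exists (hard_instance R s), (empirical R s); split=> //; split=> // rule valid.
have /andP[E0 E2m] :
    0 < kp_expected_weight (hard_instance R s) rule (empirical R s)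
      <= 2 * (size s)%:R.
  apply: kp_expected_weight_bounds => // pi pis.
  by rewrite /empirical (count_memPn pis) mul0r.
rewrite /kp_competitive_ratio ler_pdivlMr // -/L -/F.
apply: le_trans (hard_opt_ge R s); rewrite natrB ?(ltnW mn') // ss.
have X0 : 0 <= 1 / 32 * (delta ^+ 2 / F) * (n%:R / L).
  rewrite !mulr_ge0 ?invr_ge0 ?ltW //; lra.
apply: le_trans (ler_wpM2l X0 E2m) _; rewrite ss.
apply: le_trans (_ : _ * (2 * (2 * (A * L))) <= _).
  by apply: ler_wpM2l => //; lra.
rewrite [leLHS](_ : _ = n%:R / 2); first by lra.
by rewrite /A; field; rewrite !gt_eqF //; lra.
Qed.
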